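(* Let $H$ and $K$ be Hilbert spaces and let $\{x_n\}_{n\in I}$ and $\{y_m\}_{m\in J}$ be frames in $H$ and $K$, respectively. Let $0\ne\lambda\in\mathbb{C}$. Writing $'$ for the dual frame, for all $n\in I$ and $m\in J$: (i) $(x_n\otimes y_m)'=x_n'\otimes y_m'$, where the left side refers to the dual frame of $\{x_n\otimes y_m\}_{n\in I,m\in J}$ in $H\otimes K$; (ii) $(\lambda x_n)'=(\bar\lambda)^{-1}x_n'$, where the left side refers to the dual frame of $\{\lambda x_n\}_{n\in I}$; (iii) $(x_n')'=x_n$, where the left side refers to the dual frame of $\{x_n'\}_{n\in I}$.
   Context: All Hilbert spaces are complex and separable, with inner product $\langle\cdot,\cdot\rangle$ linear in the first variable; all index sets are countable or finite. A family $\{x_i\}_{i\in J}$ in a Hilbert space $H$ is a frame for $H$ if there are constants $A,B>0$ with $A\|x\|^2\le\sum_i|\langle x,x_i\rangle|^2\le B\|x\|^2$ for all $x\in H$. Its frame operator is the bounded, positive, invertible linear operator $S$ on $H$ given by $Sx=\sum_i\langle x,x_i\rangle x_i$. The (canonical) dual frame of $\{x_i\}_{i\in J}$ is the frame $\{x_i'\}_{i\in J}$ defined by $x_i'=S^{-1}x_i$. For Hilbert spaces $H,K$, the tensor product $H\otimes K$ is the set of all bounded antilinear maps $T:K\to H$ with $\sum_j\|Tu_j\|^2<\infty$ for some (equivalently every) orthonormal basis $\{u_j\}$ of $K$; it is a Hilbert space with inner product $\langle Q,T\rangle=\sum_j\langle Qu_j,Tu_j\rangle$ (independent of the basis). For $x\in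 H$, $y\in K$, the element $x\otimes y\in H\otimes K$ is the map $(x\otimes y)(y')=\langle y,y'\rangle x$, $y'\in K$. If $\{x_n\}$ and $\{y_m\}$ are frames for $H$ and $K$, then $\{x_n\otimes y_m\}$ is a frame for $H\otimes K$. *)

(* Defs.v *)
From HB Require Import structures.
From mathcomp Require Import all_boot all_order all_algebra finmap.
From mathcomp Require Import sesquilinear complex.
From mathcomp Require Import all_classical all_reals.
From mathcomp Require Import ereal topology normedtype sequences esum.
From mathcomp Require Import ring lra.
From mathcomp.analysis.showcase Require summability.

Set Implicit Arguments.
Unset Strict Implicit.
Unset Printing Implicit Defensive.

Import Order.TTheory GRing.Theory Num.Theory Num.Def.
Import numFieldNormedType.Exports.

Local Open Scope classical_set_scope.
Local Open Scope ring_scope.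

Section rnorm.
Variable R : realType.
Implicit Types V : normedZmodType R[i].

(* The norm of a normedModType R[i] is R[i]-valued; this is the same norm
   as an element of R. *)
Definition rnorm V (x : V) : R := complex.Re `|x|.

Lemma rnormE V (x : V) : (rnorm x)%:C%C = `|x|.
Proof. by rewrite /rnorm RRe_real // normr_real. Qed.

Lemma rnorm_ge0 V (x : V) : 0 <= rnorm x.
Proof. by rewrite -ler0c rnormE. Qed.

Lemma ltcRe (e : R[i]) : 0 < e -> exists2 r : R, 0 < r & e = r%:C%C.
Proof.
case: e => a b; rewrite ltcE /= => /andP[/eqP -> a0].
by exists a.
Qed.

Lemma rnormD V (x y : V) : rnorm (x + y) <= rnorm x + rnorm y.
Proof. by rewrite -lecR raddfD /= !rnormE ler_normD. Qed.

Lemma rnorm0 V : rnorm (0 : V) = 0.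
Proof. by rewrite /rnorm normr0. Qed.

Lemma rnormN V (x : V) : rnorm (- x) = rnorm x.
Proof. by rewrite /rnorm normrN. Qed.

Lemma rnorm_dist V (x y : V) : `|rnorm x - rnorm y| <= rnorm (x - y).
Proof.
have h1 := rnormD (x - y) y; have h2 := rnormD (y - x) x.
rewrite subrK in h1; rewrite subrK -(rnormN (y - x)) opprB in h2.
by rewrite ler_norml; apply/andP; split; lra.
Qed.

Lemma rnorm_eq0 V (x : V) : rnorm x = 0 -> x = 0.
Proof. by move=> h; apply/eqP; rewrite -normr_eq0 -rnormE h. Qed.

Lemma rnormM (x y : R[i]) : rnorm (x * y) = rnorm x * rnorm y.
Proof. by apply: complexI; rewrite rmorphM /= !rnormE normrM. Qed.

Lemma rnormZ (V : normedModType R[i]) a (x : V) : rnorm (a *: x) = rnorm a * rnorm x.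
Proof. by apply: complexI; rewrite rmorphM /= !rnormE normrZ. Qed.

Lemma rnorm_conj (x : R[i]) : rnorm x^* = rnorm x.
Proof. by rewrite /rnorm norm_conjC. Qed.

Lemma rnorm_real (x : R) : 0 <= x -> rnorm x%:C%C = x.
Proof. by move=> x0; apply: complexI; rewrite rnormE ger0_norm // ler0c. Qed.

Lemma sqr_rnormC (x : R[i]) : (rnorm x ^+ 2)%:C%C = x * x^*.
Proof. by rewrite rmorphXn /= rnormE normCK. Qed.

Lemma rnorm_sum V (I : Type) (r : seq I) (F : I -> V) :
  rnorm (\sum_(i <- r) F i) <= \sum_(i <- r) rnorm (F i).
Proof.
elim: r => [|i r IH]; first by rewrite !big_nil rnorm0.
by rewrite !big_cons (le_trans (rnormD _ _)) // lerD2l.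
Qed.

End rnorm.

Section complex_complete.
Variable R : realType.
Local Notation C := R[i].

Lemma rnorm_Re (z : C) : `|complex.Re z| <= rnorm z.
Proof. by rewrite -lecR rnormE normc_ge_Re. Qed.

Lemma rnorm_Im (z : C) : `|complex.Im z| <= rnorm z.
Proof.
have := rnorm_Re (z * 'i%C); rewrite ReiNIm normrN rnormM.
suff -> : rnorm ('i%C : C) = 1 by rewrite mulr1.
by apply: complexI; rewrite rnormE normc_def /= expr0n expr1n add0r sqrtr1.
Qed.

Lemma rnorm_ReIm (z : C) : rnorm z <= `|complex.Re z| + `|complex.Im z|.
Proof.
rewrite {1}[z]complexE (le_trans (rnormD _ _)) //; apply: lerD.
  by rewrite -lecR rnormE normc_def /= expr0n addr0 sqrtr_sqr.
rewrite rnormM; have -> : rnorm ('i%C : C) = 1.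
  by apply: complexI; rewrite rnormE normc_def /= expr0n expr1n add0r sqrtr1.
by rewrite mul1r -lecR rnormE normc_def /= expr0n addr0 sqrtr_sqr.
Qed.

Lemma complex_cauchy_cvg (F : set_system C^o) :
  ProperFilter F -> cauchy F -> cvg F.
Proof.
move=> FF /cauchy_ballP Fc.
have small (e : R) : 0 < e -> exists2 A : set C, F A &
   forall z w, A z -> A w -> rnorm (z - w) < e.
  move=> e0; have e0' : (0 : C) < e%:C%C by rewrite ltcR.
  have [[A B] [/= FA FB] AB] := Fc _ e0'.
  exists (A `&` B); first exact: filterI.
  move=> z w [Az _] [_ Bw]; have := AB (z, w) (conj Az Bw).
  by rewrite /ball /= -rnormE ltcR.
have proj (p : C -> R) : (forall z w, `|p z - p w| <= rnorm (z - w)) ->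
    cvg (p @ F).
  move=> pl; apply: (@R_complete R); apply/cauchy_ballP => e e0.
  have [A FA Ae] := small _ e0.
  exists (p @` A, p @` A).
    by split; rewrite /= /nbhs /=; apply: filterS FA => z Az; exists z.
  move=> [_ _] [[z Az <-] [w Aw <-]].
  by rewrite /ball /= (le_lt_trans (pl _ _)) // Ae.
have /cvg_ex[a cva] : cvg (@complex.Re R @ F).
  by apply: proj => z w; rewrite (le_trans _ (rnorm_Re _)) //; case: z w => ? ? [].
have /cvg_ex[b cvb] : cvg (@complex.Im R @ F).
  by apply: proj => z w; rewrite (le_trans _ (rnorm_Im _)) //; case: z w => ? ? [].
apply/cvg_ex; exists (Complex a b); apply/cvgrPdist_lt => e /ltcRe[r r0 ->].
have r20 : 0 < r / 2 by rewrite divr_gt0.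
move/cvgrPdist_lt : cva => /(_ _ r20) Fa.
move/cvgrPdist_lt : cvb => /(_ _ r20) Fb.
near=> z; rewrite -rnormE ltcR (le_lt_trans (rnorm_ReIm _)) //.
rewrite [ltRHS]splitr; apply: ltrD.
  have : `|a - complex.Re z| < r / 2 by near: z.
  by case: (z).
have : `|b - complex.Im z| < r / 2 by near: z.
by case: (z).
Unshelve. all: by end_near. Qed.

End complex_complete.

Section sums.
Variable R : realType.
Local Notation C := R[i].

(* Unconditional convergence: the finite partial sums, ordered by inclusion
   of their index sets, converge to s. *)
Definition sums (I : choiceType) (V : normedModType C) (x : I -> V) (s : V) :=
  summability.partial_sum x @ summability.totally --> s.

Lemma psumE (I : choiceType) (V : zmodType) (x : I -> V) A :
  summability.partial_sum x A = \sum_(i <- A) x i.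
Proof. by rewrite /summability.partial_sum big_seq_fsetE. Qed.

#[local] Existing Instance summability.totally_filter.

Lemma big_fset_sub (I : choiceType) (V : zmodType) (F : I -> V) (A0 A : {fset I}) :
  (A0 `<=` A)%fset ->
  \sum_(i <- A) F i = \sum_(i <- A0) F i + \sum_(i <- (A `\` A0)%fset) F i.
Proof.
move=> A0A; rewrite (big_fsetID _ (mem A0)) /=; congr (_ + _).
  apply: eq_fbigl => i; rewrite !inE /= andbC.
  by case: (boolP (i \in A0)) => //= /(fsubsetP A0A) ->.
by apply: eq_fbigl => i; rewrite !inE /= andbC.
Qed.

Lemma sumsP (I : choiceType) (V : normedModType C) (x : I -> V) (s : V) :
  sums x s <-> forall e : R, 0 < e -> exists A0 : {fset I},
    forall A, (A0 `<=` A)%fset -> rnorm (s - \sum_(i <- A) x i) < e.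
Proof.
split.
  move/cvgrPdist_lt => h e e0.
  have [|A0 _ hA] := h e%:C%C; first by rewrite ltcR.
  by exists A0 => A /hA /=; rewrite -rnormE ltcR psumE.
move=> h; apply/cvgrPdist_lt => e /ltcRe[r r0 ->].
have [A0 hA] := h _ r0; exists A0 => // A /= /hA.
by rewrite -rnormE ltcR psumE.
Qed.

Lemma sums_unique (I : choiceType) (V : normedModType C) (x : I -> V) s t :
  sums x s -> sums x t -> s = t.
Proof. by move=> xs xt; apply: (cvg_unique _ xs xt). Qed.

Lemma sumE (I : choiceType) (V : normedModType C) (x : I -> V) s :
  sums x s -> summability.sum x = s.
Proof. by move=> xs; apply/cvg_lim. Qed.

Lemma sumsZD (I : choiceType) (V : normedModType C) (x y : I -> V) a s t :
  sums x s -> sums y t -> sums (fun i => a *: x i + y i) (a *: s + t).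
Proof.
move=> xs yt; rewrite /sums.
rewrite (_ : summability.partial_sum _ = fun A => a *: summability.partial_sum x A
    + summability.partial_sum y A); last first.
  by apply/funext => A; rewrite !psumE big_split /= scaler_sumr.
by apply: cvgD => //; apply: cvgZr.
Qed.

Lemma sums_map (I : choiceType) (V W : normedModType C) (g : V -> W) (M : R)
    (x : I -> V) s :
  {morph g : a b / a + b} -> (forall v, rnorm (g v) <= M * rnorm v) ->
  sums x s -> sums (g \o x) (g s).
Proof.
move=> gD gM /sumsP xs; apply/sumsP => e e0.
have g0 : g 0 = 0 by apply: (addrI (g 0)); rewrite -gD !addr0.
have M0 : 0 < `|M| + 1 by rewrite ltr_wpDl.
have [|A0 hA] := xs (e / (`|M| + 1)); first by rewrite divr_gt0.
exists A0 => A /hA; rewrite -(big_morph g gD g0).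
have gN v : g (- v) = - g v by apply: (addrI (g v)); rewrite -gD !subrr.
rewrite -gN -gD ltr_pdivlMr // => h; apply: le_lt_trans h.
rewrite (le_trans (gM _)) // mulrC ler_wpM2l ?rnorm_ge0 //.
by rewrite (le_trans (ler_norm M)) // lerDl.
Qed.

Lemma sums_cauchy (I : choiceType) (V : normedModType C) (x : I -> V) :
  (forall F : set_system V, ProperFilter F -> cauchy F -> cvg F) ->
  (forall e : R, 0 < e -> exists A0 : {fset I}, forall B : {fset I},
     [disjoint A0 & B]%fset -> rnorm (\sum_(i <- B) x i) < e) ->
  exists s, sums x s.
Proof.
move=> cV h; apply/cvg_ex; apply: cV; apply: cauchy_exP => e /ltcRe[r r0 ->].
have [A0 hA] := h _ r0; exists (\sum_(i <- A0) x i).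
exists A0 => // A /= A0A; rewrite -ball_normE /ball_ /= -rnormE ltcR psumE.
rewrite -rnormN opprB.
have -> : \sum_(i <- A) x i - \sum_(i <- A0) x i = \sum_(i <- (A `\` A0)%fset) x i.
  by rewrite (big_fset_sub _ A0A) addrC addKr.
apply: hA; apply/fdisjointP => i iA0; rewrite !inE iA0.
by [].
Qed.

Lemma sums_single (I : choiceType) (V : normedModType C) (x : I -> V) k :
  (forall i, i != k -> x i = 0) -> sums x (x k).
Proof.
move=> x0; apply/sumsP => e e0; exists [fset k]%fset => A; rewrite fsub1set => kA.
rewrite (big_fsetD1 k) //= big_seq big1 ?addr0 ?subrr ?rnorm0 //.
by move=> i; rewrite !inE => /andP[/x0].
Qed.

Section nonneg.
Variables (I : choiceType) (f : I -> R).
Hypothesis f0 : forall i, 0 <= f i.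
Local Notation S := (\esum_(i in [set: I]) (f i)%:E).

Lemma fsum_le_esum (A : {fset I}) : ((\sum_(i <- A) f i)%:E <= S)%E.
Proof.
apply: esum_ge; exists [set` A]; first by split.
by rewrite fsbig_finite //= set_fsetK sumEFin.
Qed.

Lemma esum_leP M : (forall A : {fset I}, \sum_(i <- A) f i <= M) -> (S <= M%:E)%E.
Proof.
move=> h; apply: ge_ereal_sup => _ [X [finX _] <-].
by rewrite fsbig_finite //= sumEFin lee_fin.
Qed.

Lemma esum_tail : (S < +oo)%E -> forall e : R, 0 < e -> exists A0 : {fset I},
  forall B : {fset I}, [disjoint A0 & B]%fset -> \sum_(i <- B) f i < e.
Proof.
move=> Soo e e0.
have S0 : (0 <= S)%E by apply: esum_ge0 => i _; rewrite lee_fin.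
have Sfin : S \is a fin_num by rewrite ge0_fin_numE.
have : (S - e%:E < S)%E by rewrite lteBlDr // lteDl // lte_fin.
move/ereal_sup_gt => [_ [X [finX _] <-]].
rewrite fsbig_finite //= sumEFin.
rewrite -(fineK Sfin) -EFinB lte_fin ltrBlDr => hX.
exists (fset_set X) => B dis.
have := fsum_le_esum (fset_set X `|` B)%fset.
rewrite (big_fset_sub _ (fsubsetUl _ _)).
have -> : ((fset_set X `|` B) `\` fset_set X = B)%fset.
  apply/fsetP => i; rewrite !inE; case: (boolP (i \in fset_set X)) => //= iX.
  by rewrite (negbTE (fdisjointP dis _ iX)).
move=> h.
rewrite -(fineK Sfin) lee_fin in h.
by rewrite -(ltrD2l (\sum_(i <- fset_set X) f i)) (le_lt_trans h).
Qed.

Lemma sums_esum r : S = r%:E -> sums (fun i => (f i)%:C%C : C^o) r%:C%C.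
Proof.
move=> Sr; apply/sumsP => e e0.
have : (S - e%:E < S)%E by rewrite Sr -EFinB lte_fin ltrBlDr ltrDl.
move/ereal_sup_gt => [_ [X [finX _] <-]].
rewrite fsbig_finite //= sumEFin Sr -EFinB lte_fin => hX.
exists (fset_set X) => A XA.
rewrite -raddf_sum /= -raddfB /= rnorm_real; last first.
  by rewrite subr_ge0 -lee_fin -Sr fsum_le_esum.
rewrite ltrBlDr addrC -ltrBlDr (lt_le_trans hX) //.
by rewrite [leRHS](big_fset_sub _ XA) lerDl sumr_ge0.
Qed.

End nonneg.

Lemma sums_abs (I : choiceType) (x : I -> C^o) :
  (\esum_(i in [set: I]) (rnorm (x i))%:E < +oo)%E -> exists s, sums x s.
Proof.
move=> /esum_tail h; apply: (@sums_cauchy _ _ _ (@complex_cauchy_cvg R)) => e e0.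
have [|A0 hA] := h _ e e0; first by move=> i; exact: rnorm_ge0.
exists A0 => B /hA; apply: le_lt_trans; exact: rnorm_sum.
Qed.

End sums.

(* {dot H for conjC}: positive definite, hermitian, linear in the first
   variable and conjugate-linear in the second one. *)
HB.mixin Record isHilbert (R : realType) H & CompleteNormedModule R[i] H := {
  inner : {dot H for conjC};
  innerE : forall x : H, inner x x = `|x| ^+ 2
}.

#[short(type="hilbertType")]
HB.structure Definition Hilbert (R : realType) :=
  {H of CompleteNormedModule R[i] H & isHilbert R H}.

Section dot_theory.
Variables (C : numClosedFieldType) (U : lmodType C) (form : {dot U for conjC}).

Lemma dot_conj u v : (form u v)^* = form v u.
Proof. by rewrite [RHS]hermC /= mul1r. Qed.

Lemma dot_CauchySchwarz u v : `|form u v| ^+ 2 <= form u u * form v v.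
Proof.
have [->|v0] := eqVneq v 0.
  by rewrite !linear0r normr0 expr0n mulr0.
have vv : 0 < form v v by rewrite dnorm_gt0.
have := dnorm_ge0 form (form v v *: u - form u v *: v).
rewrite linearBl !linearBr /= !linearZl_LR !linearZr_LR /=.
rewrite !dot_conj [form v u * form v v]mulrC subrr subr0 -mulrBr.
rewrite pmulr_rge0 // subr_ge0 normCK dot_conj mulrC => /le_trans; apply.
by rewrite mulrC.
Qed.

Lemma dot_triangle u v :
  sqrtC (form (u + v) (u + v)) <= sqrtC (form u u) + sqrtC (form v v).
Proof.
have ge0 w : 0 <= form w w by exact: dnorm_ge0.
rewrite -(ler_pXn2r (n := 2)) ?nnegrE ?addr_ge0 ?sqrtC_ge0 //.
rewrite sqrtCK sqrrD !sqrtCK dnormD addrAC lerD2r lerD2l.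
have Rr : form u v + (form u v)^* \is Num.real.
  by rewrite CrealE rmorphD /= conjCK addrC.
rewrite (le_trans (real_ler_norm Rr)) // (le_trans (ler_normD _ _)) //.
rewrite norm_conjC -mulr2n lerMn2r /=.
rewrite -(ler_pXn2r (n := 2)) ?nnegrE ?mulr_ge0 ?sqrtC_ge0 //.
by rewrite exprMn !sqrtCK dot_CauchySchwarz.
Qed.

End dot_theory.

Section hilbert_theory.
Variable R : realType.
Local Notation C := R[i].
Implicit Types H K : hilbertType R.

Lemma innerDl H (x y z : H) : inner (x + y) z = inner x z + inner y z.
Proof. exact: linearDl. Qed.

Lemma innerDr H (x y z : H) : inner z (x + y) = inner z x + inner z y.
Proof. exact: linearDr. Qed.

Lemma innerZl H a (x z : H) : inner (a *: x) z = a * inner x z.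
Proof. by rewrite linearZl_LR. Qed.

Lemma innerZr H a (x z : H) : inner z (a *: x) = a^* * inner z x.
Proof. by rewrite linearZr_LR. Qed.

Lemma inner0l H (z : H) : inner (0 : H) z = 0.
Proof. by rewrite linear0l. Qed.

Lemma inner0r H (z : H) : inner z (0 : H) = 0.
Proof. by rewrite linear0r. Qed.

Lemma innerBl H (x y z : H) : inner (x - y) z = inner x z - inner y z.
Proof. by rewrite linearBl. Qed.

Lemma innerC H (x y : H) : (inner x y)^* = inner y x.
Proof. exact: dot_conj. Qed.

Lemma inner_suml H (I : Type) (r : seq I) (F : I -> H) z :
  inner (\sum_(i <- r) F i) z = \sum_(i <- r) inner (F i) z.
Proof.
apply: (big_morph (fun x => inner x z)); last exact: inner0l.
by move=> x y; exact: innerDl.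
Qed.

Lemma inner_sumr H (I : Type) (r : seq I) (F : I -> H) z :
  inner z (\sum_(i <- r) F i) = \sum_(i <- r) inner z (F i).
Proof.
apply: (big_morph (fun x => inner z x)); last exact: inner0r.
by move=> x y; exact: innerDr.
Qed.

Lemma innerrE H (x : H) : inner x x = (rnorm x ^+ 2)%:C%C.
Proof. by rewrite innerE -rnormE rmorphXn. Qed.

Lemma rnorm_inner H (x y : H) : rnorm (inner x y) <= rnorm x * rnorm y.
Proof.
rewrite -(ler_pXn2r (n := 2)) ?nnegrE ?mulr_ge0 ?rnorm_ge0 //.
rewrite -lecR rmorphXn /= rnormE (le_trans (dot_CauchySchwarz _ _ _)) //.
by rewrite !innerrE -rmorphM -exprMn.
Qed.

Lemma inner_ext H (x : H) : (forall y, inner x y = 0) -> x = 0.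
Proof.
move=> /(_ x); rewrite innerE => /eqP; rewrite expf_eq0 /= normr_eq0.
by move/eqP.
Qed.

Lemma sums_innerl (I : choiceType) H (x : I -> H) s z : sums x s ->
  sums (fun i => inner (x i) z : C^o) (inner s z).
Proof.
apply: (@sums_map _ _ H C^o (fun v => inner v z) (rnorm z)).
  by move=> a b; exact: innerDl.
by move=> v; rewrite mulrC; exact: rnorm_inner.
Qed.

Lemma sums_innerr (I : choiceType) H (x : I -> H) s z : sums x s ->
  sums (fun i => inner z (x i) : C^o) (inner z s).
Proof.
apply: (@sums_map _ _ H C^o (fun v => inner z v) (rnorm z)).
  by move=> a b; exact: innerDr.
by move=> v; exact: rnorm_inner.
Qed.

Definition orthonormal_family (J : choiceType) H (u : J -> H) :=
  forall j k, inner (u j) (u k) = (j == k)%:R.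

(* Maximal orthonormal families. In a separable space they are automatically
   countable, so that J is not required to be a countType. *)
Definition orthonormal_basis (J : choiceType) H (u : J -> H) :=
  orthonormal_family u /\
  forall x : H, (forall j, inner x (u j) = 0) -> x = 0.

Lemma inner_ortho_sum (J : choiceType) H (u : J -> H) (c : J -> C) (A : {fset J}) :
  orthonormal_family u ->
  rnorm (\sum_(j <- A) c j *: u j) ^+ 2 = \sum_(j <- A) rnorm (c j) ^+ 2.
Proof.
move=> ou; apply: complexI; rewrite -innerrE inner_suml raddf_sum /=.
apply: eq_big_seq => j jA.
rewrite innerZl inner_sumr (big_fsetD1 j) //= big_seq big1 => [|k].
  by rewrite addr0 innerZr ou eqxx mulr1 sqr_rnormC.
by rewrite !inE innerZr ou eq_sym => /andP[/negbTE -> _]; rewrite mulr0.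
Qed.

Lemma ortho_sums (J : choiceType) H (u : J -> H) (c : J -> C) :
  orthonormal_family u ->
  (\esum_(j in [set: J]) (rnorm (c j) ^+ 2)%:E < +oo)%E ->
  exists s, sums (fun j => c j *: u j) s.
Proof.
move=> ou /esum_tail h; apply: sums_cauchy; first exact: cauchy_cvg.
move=> e e0; have [||A0 hA] := h _ (e ^+ 2); first by move=> j; rewrite sqr_ge0.
  by rewrite exprn_gt0.
exists A0 => B /hA; rewrite -(inner_ortho_sum c B ou).
by rewrite ltr_pXn2r // nnegrE ?rnorm_ge0 // ltW.
Qed.

Lemma ortho_coef (J : choiceType) H (u : J -> H) (c : J -> C) s k :
  orthonormal_family u -> sums (fun j => c j *: u j) s -> inner s (u k) = c k.
Proof.
move=> ou /(@sums_innerl _ _ _ _ (u k)) h; apply: (sums_unique h).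
rewrite [X in sums _ X](_ : _ = (fun j => inner (c j *: u j) (u k)) k).
  by apply: sums_single => j jk; rewrite innerZl ou (negbTE jk) mulr0.
by rewrite innerZl ou eqxx mulr1.
Qed.

Lemma bessel (J : choiceType) H (u : J -> H) x : orthonormal_family u ->
  (\esum_(j in [set: J]) (rnorm (inner x (u j)) ^+ 2)%:E <= (rnorm x ^+ 2)%:E)%E.
Proof.
move=> ou; apply: esum_leP => A.
set s := \sum_(j <- A) inner x (u j) *: u j.
have xs : inner x s = (rnorm s ^+ 2)%:C%C.
  rewrite (inner_ortho_sum _ A ou) inner_sumr raddf_sum /=; apply: eq_bigr => j _.
  by rewrite innerZr mulrC sqr_rnormC.
rewrite -(inner_ortho_sum _ A ou) -/s.
have [->|s0] := eqVneq (rnorm s) 0; first by rewrite expr0n sqr_ge0.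
have sp : 0 < rnorm s by rewrite lt_def s0 rnorm_ge0.
rewrite ler_pXn2r ?nnegrE ?rnorm_ge0 // -(ler_pM2r sp).
rewrite -expr2 (le_trans _ (rnorm_inner x s)) // xs rnorm_real //.
by rewrite sqr_ge0.
Qed.

Lemma bessel_fin (J : choiceType) H (u : J -> H) x : orthonormal_family u ->
  (\esum_(j in [set: J]) (rnorm (inner x (u j)) ^+ 2)%:E < +oo)%E.
Proof. by move=> /(bessel x) /le_lt_trans; apply; rewrite ltry. Qed.

Lemma onb_expansion (J : choiceType) H (u : J -> H) x : orthonormal_basis u ->
  sums (fun j => inner x (u j) *: u j) x.
Proof.
move=> [ou bu]; have [s ss] := ortho_sums ou (bessel_fin x ou).
suff xs : x = s by rewrite -xs in ss.
apply/eqP; rewrite -subr_eq0; apply/eqP; apply: bu => j.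
by rewrite innerBl (ortho_coef j ou ss) subrr.
Qed.

Lemma parseval (J : choiceType) H (u : J -> H) x : orthonormal_basis u ->
  (\esum_(j in [set: J]) (rnorm (inner x (u j)) ^+ 2)%:E = (rnorm x ^+ 2)%:E)%E.
Proof.
move=> bu; have := bessel_fin x bu.1.
set S := (X in (X < _)%E) => Soo.
have S0 : (0 <= S)%E by apply: esum_ge0 => i _; rewrite lee_fin sqr_ge0.
have Sf : S = (fine S)%:E by rewrite fineK // ge0_fin_numE.
rewrite -[LHS]/S Sf; congr _%:E; apply: complexI.
have nn j : 0 <= rnorm (inner x (u j)) ^+ 2 by rewrite sqr_ge0.
apply: (@sums_unique _ _ C^o _ _ _ (sums_esum nn Sf)).
rewrite -innerrE.
have := @sums_innerl _ _ _ _ x (@onb_expansion _ _ _ x bu).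
rewrite (_ : (fun j => _) = fun j => (rnorm (inner x (u j)) ^+ 2)%:C%C) //.
by apply/funext => j; rewrite innerZl -(innerC x (u j)) sqr_rnormC.
Qed.

Lemma onb_exists H : exists B : set H, orthonormal_basis (fun b : B => val b).
Proof.
pose P (B : set H) := forall x y, B x -> B y -> inner x y = (x == y)%:R.
have [] := @Zorn_bigcup H P.
  move=> F FP tF x y [X FX Xx] [Y FY Yy].
  have [XY|YX] := tF _ _ FX FY; first by apply: (FP _ FY) => //; exact: XY.
  by apply: (FP _ FX) => //; exact: YX.
move=> B [PB Bmax]; exists B; split.
  move=> j k; rewrite PB //; first exact: set_valP. exact: set_valP.
move=> x xB; apply: contrapT => /eqP x0.
have nx : `|x| != 0 by rewrite normr_eq0.
pose v := `|x|^-1 *: x.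
have vB b : B b -> inner v b = 0.
  move=> Bb; rewrite innerZl; have := xB (SigSub (mem_set Bb)) => /= ->.
  by rewrite mulr0.
have vv : inner v v = 1 by rewrite innerE normfZV // expr1n.
have nvB : ~ B v by move=> /vB; rewrite vv => /eqP; rewrite oner_eq0.
apply: (Bmax (B `|` [set v])).
  by split; [exact: subsetUl|move=> /(_ v (or_intror erefl))].
have vbN b : B b -> (v == b) = false.
  by move=> Bb; apply/eqP => vb; apply: nvB; rewrite vb.
move=> y z [By|->] [Bz|->].
- exact: PB.
- by rewrite -innerC vB // conjC0 eq_sym vbN.
- by rewrite vB // vbN.
- by rewrite vv eqxx.
Qed.

End hilbert_theory.

Section esum_more.
Variable R : realType.

Lemma esum_swap (I J : choiceType) (a : I -> J -> \bar R) :
  (forall i j, 0 <= a i j)%E ->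
  (\esum_(i in [set: I]) \esum_(j in [set: J]) a i j =
   \esum_(j in [set: J]) \esum_(i in [set: I]) a i j)%E.
Proof.
move=> a0; rewrite !esum_esum //.
rewrite (reindex_esum ([set: J] `*`` fun _ => [set: I]) _
  (fun k : J * I => (k.2, k.1))) //=.
split; first by move=> [].
- by move=> [? ?] [? ?] _ _ /= [-> ->].
- by move=> [i j] _; exists (j, i).
Qed.

Lemma esum_bddP (I : choiceType) (f : I -> R) : (forall i, 0 <= f i) ->
  ((\esum_(i in [set: I]) (f i)%:E < +oo)%E <->
   exists M, forall A : {fset I}, \sum_(i <- A) f i <= M).
Proof.
move=> f0; split.
  move=> Soo; have S0 : (0 <= \esum_(i in [set: I]) (f i)%:E)%E.
    by apply: esum_ge0 => i _; rewrite lee_fin.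
  exists (fine (\esum_(i in [set: I]) (f i)%:E)) => A.
  by rewrite -lee_fin fineK ?ge0_fin_numE // fsum_le_esum.
by move=> [M hM]; rewrite (le_lt_trans (esum_leP hM)) // ltry.
Qed.

End esum_more.

Section hilbert_schmidt.
Variables (R : realType) (H K : hilbertType R).
Local Notation C := R[i].
Implicit Types T Q : K -> H.

Definition antilinear T := forall a u v, T (a *: u + v) = a^* *: T u + T v.

Definition bounded_map T := exists M : R, forall u, rnorm (T u) <= M * rnorm u.

Definition hs_sum (J : choiceType) (u : J -> K) T : \bar R :=
  \esum_(j in [set: J]) (rnorm (T (u j)) ^+ 2)%:E.

Definition hilbert_schmidt T := [/\ antilinear T, bounded_map T &
  exists (J : choiceType) (u : J -> K),
    orthonormal_basis u /\ (hs_sum u T < +oo)%E].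

Lemma antilinearD T : antilinear T -> {morph T : u v / u + v}.
Proof. by move=> aT u v; rewrite -[u]scale1r aT conjC1 !scale1r. Qed.

Lemma antilinear0 T : antilinear T -> T 0 = 0.
Proof.
move=> aT; apply: (addrI (T 0)).
by rewrite -antilinearD // !addr0.
Qed.

Lemma antilinearZ T : antilinear T -> forall a u, T (a *: u) = a^* *: T u.
Proof.
by move=> aT a u; rewrite -[a *: u]addr0 aT (antilinear0 aT) addr0.
Qed.

Lemma antilinear_sums T (I : choiceType) (x : I -> K) s :
  antilinear T -> bounded_map T -> sums x s -> sums (T \o x) (T s).
Proof.
by move=> aT [M bT]; apply: (@sums_map _ _ K H T M) => //; exact: antilinearD.
Qed.

Lemma adjoint_exists T v : antilinear T -> bounded_map T ->
  exists w : K, forall k, inner (T k) v = inner w k.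
Proof.
move=> aT bT; have [B] := onb_exists K.
set u := fun b : B => val b => bu.
pose g j := inner (T (u j)) v.
have [|w ww] := @ortho_sums _ _ K u g bu.1.
  apply/esum_bddP; first by move=> j; rewrite sqr_ge0.
  have [M hM] := bT; exists ((`|M| * rnorm v) ^+ 2) => A.
  rewrite -(inner_ortho_sum _ _ bu.1).
  set s := \sum_(j <- A) g j *: u j.
  have sE : inner (T s) v = (rnorm s ^+ 2)%:C%C.
    rewrite (inner_ortho_sum _ _ bu.1) raddf_sum /=.
    rewrite /s (big_morph T (antilinearD aT) (antilinear0 aT)) inner_suml.
    apply: eq_bigr => j _.
    by rewrite (antilinearZ aT) innerZl mulrC sqr_rnormC.
  have [->|s0] := eqVneq (rnorm s) 0; first by rewrite expr0n sqr_ge0.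
  have sp : 0 < rnorm s by rewrite lt_def s0 rnorm_ge0.
  rewrite ler_pXn2r ?nnegrE ?mulr_ge0 ?rnorm_ge0 // -(ler_pM2r sp).
  rewrite -expr2 -[leLHS]rnorm_real ?sqr_ge0 // -sE.
  rewrite (le_trans (rnorm_inner _ _)) // mulrAC ler_wpM2r ?rnorm_ge0 //.
  rewrite (le_trans (hM _)) // ler_wpM2r ?rnorm_ge0 //.
  exact: ler_norm.
exists w => k.
have h1 := @sums_innerl _ _ K _ _ k ww.
have h2 := @sums_innerl _ _ H _ _ v
  (antilinear_sums aT bT (@onb_expansion _ _ _ _ k bu)).
apply: (@sums_unique _ _ C^o _ _ _ h2); move: h1.
rewrite (_ : (fun i => _) = fun i => inner ((T \o (fun j => inner k (u j) *: u j)) i) v) //.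
apply/funext => j /=.
by rewrite (antilinearZ aT) !innerZl innerC mulrC.
Qed.

Lemma hs_sum_adjoint (J L : choiceType) (u : J -> K) (v : L -> H) T (w : L -> K) :
  orthonormal_basis u -> orthonormal_basis v ->
  (forall l k, inner (T k) (v l) = inner (w l) k) ->
  hs_sum u T = \esum_(l in [set: L]) (rnorm (w l) ^+ 2)%:E.
Proof.
move=> bu bv adj; rewrite /hs_sum.
under eq_esum do rewrite -(parseval _ bv).
rewrite esum_swap; last by move=> i j; rewrite lee_fin sqr_ge0.
apply: eq_esum => l _; rewrite -(parseval _ bu).
by apply: eq_esum => j _; rewrite adj.
Qed.

Lemma hs_adjoint T : antilinear T -> bounded_map T ->
  exists (L : choiceType) (v : L -> H) (w : L -> K),
   orthonormal_basis v /\ (forall l k, inner (T k) (v l) = inner (w l) k).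
Proof.
move=> aT bT; have [D bv] := onb_exists H.
have /choice[w hw] : forall l : D, exists w : K, forall k,
    inner (T k) (val l) = inner w k by move=> l; exact: adjoint_exists.
by exists D, (fun l : D => val l), w.
Qed.

Lemma hs_sum_indep (J J' : choiceType) (u : J -> K) (u' : J' -> K) T :
  antilinear T -> bounded_map T ->
  orthonormal_basis u -> orthonormal_basis u' -> hs_sum u T = hs_sum u' T.
Proof.
move=> aT bT bu bu'; have [L [v [w [bv adj]]]] := hs_adjoint aT bT.
by rewrite (hs_sum_adjoint bu bv adj) (hs_sum_adjoint bu' bv adj).
Qed.

Lemma hs_fin (J : choiceType) (u : J -> K) T :
  hilbert_schmidt T -> orthonormal_basis u -> (hs_sum u T < +oo)%E.
Proof.
by move=> [aT bT [J' [u' [bu' fT]]]] bu; rewrite (hs_sum_indep aT bT bu bu').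
Qed.

Lemma hs_bound (J : choiceType) (u : J -> K) T r k :
  antilinear T -> bounded_map T -> orthonormal_basis u ->
  (hs_sum u T <= r%:E)%E ->
  rnorm (T k) ^+ 2 <= r * rnorm k ^+ 2.
Proof.
move=> aT bT bu; have [L [v [w [bv adj]]]] := hs_adjoint aT bT.
rewrite (hs_sum_adjoint bu bv adj) => hr.
rewrite -lee_fin -(parseval _ bv); apply: esum_leP => A.
apply: (@le_trans _ _ (\sum_(l <- A) rnorm (w l) ^+ 2 * rnorm k ^+ 2)).
  apply: ler_sum => l _; rewrite adj -exprMn.
  by rewrite ler_pXn2r ?nnegrE ?mulr_ge0 ?rnorm_ge0 // rnorm_inner.
rewrite -mulr_suml ler_wpM2r ?sqr_ge0 // -lee_fin (le_trans _ hr) //.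
by apply: fsum_le_esum => l; rewrite sqr_ge0.
Qed.

Lemma hs0 : hilbert_schmidt (0 : K -> H).
Proof.
have [B bu] := onb_exists K; split.
- by move=> a u v; rewrite /= scaler0 addr0.
- by exists 0 => u; rewrite mul0r rnorm0.
- exists B, (fun b : B => val b); split => //.
  rewrite /hs_sum esum1 ?ltry // => i _.
  by rewrite rnorm0 expr0n.
Qed.

Lemma hsZD a T Q : hilbert_schmidt T -> hilbert_schmidt Q ->
  hilbert_schmidt (a *: T + Q).
Proof.
move=> hT hQ; have [[aT [M bT] _] [aQ [N bQ] _]] := (hT, hQ).
have [B bu] := onb_exists K; split.
- move=> b u v; rewrite !fctE aT aQ !scalerDr !scalerA [a * _]mulrC.
  by rewrite addrACA.
- exists (rnorm a * M + N) => u; rewrite (le_trans (rnormD _ _)) //.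
  by rewrite mulrDl lerD // rnormZ -mulrA ler_wpM2l ?rnorm_ge0.
- exists B, (fun b : B => val b); split => //.
  have /esum_bddP[|T' hT'] := hs_fin hT bu; first by move=> j; rewrite sqr_ge0.
  have /esum_bddP[|Q' hQ'] := hs_fin hQ bu; first by move=> j; rewrite sqr_ge0.
  apply/esum_bddP; first by move=> j; rewrite sqr_ge0.
  exists ((rnorm a ^+ 2 * T' + Q') *+ 2) => A.
  apply: (@le_trans _ _ ((rnorm a ^+ 2 * (\sum_(i <- A) rnorm (T (val i)) ^+ 2) +
     \sum_(i <- A) rnorm (Q (val i)) ^+ 2) *+ 2)).
    rewrite mulr_sumr -big_split /= -sumrMnl; apply: ler_sum => j _.
    have : rnorm ((a *: T + Q) (val j)) <= rnorm a * rnorm (T (val j)) + rnorm (Q (val j)).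
      by rewrite (le_trans (rnormD _ _)) // rnormZ.
    rewrite -exprMn; set x := rnorm _; set y := rnorm a * _; set z := rnorm _.
    move=> xyz; apply: (@le_trans _ _ ((y + z) ^+ 2)).
      by rewrite ler_pXn2r ?nnegrE ?addr_ge0 ?mulr_ge0 ?rnorm_ge0.
    rewrite -subr_ge0 (_ : _ - _ = (y - z) ^+ 2) ?sqr_ge0 //.
    by ring.
  by rewrite lerMn2r /= lerD // ler_wpM2l ?sqr_ge0.
Qed.

End hilbert_schmidt.

Section tensor_type.
Variables (R : realType) (H K : hilbertType R).

Definition hs_pred : {pred K -> H} := mem [set T | hilbert_schmidt T].

(* The carrier of the Hilbert space tensor product of H and K. *)
Record tensor : Type := Tensor {
  tensor_fun :> K -> H;
  tensor_hs : tensor_fun \in hs_pred }.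

HB.instance Definition _ := [isSub for tensor_fun].
HB.instance Definition _ := gen_eqMixin tensor.
HB.instance Definition _ := gen_choiceMixin tensor.

Lemma hs_submod_closed : submod_closed hs_pred.
Proof.
split; first by apply/mem_set/hs0.
by move=> a T Q /set_mem hT /set_mem hQ; apply/mem_set/hsZD.
Qed.

HB.instance Definition _ := GRing.isSubmodClosed.Build _ _ hs_pred hs_submod_closed.
HB.instance Definition _ := [SubChoice_isSubLmodule of tensor by <:].

End tensor_type.

Section tensor_inner.
Variables (R : realType) (H K : hilbertType R).
Local Notation C := R[i].
Implicit Types Q T : tensor H K.

Lemma tensorP T : hilbert_schmidt T.
Proof. exact: set_mem (tensor_hs T). Qed.

Lemma tensor_eqP Q T : (forall k, Q k = T k) -> Q = T.
Proof. by move=> h; apply/val_inj/funext. Qed.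

Lemma tensor_anti T : antilinear T. Proof. by case: (tensorP T). Qed.
Lemma tensor_bdd T : bounded_map T. Proof. by case: (tensorP T). Qed.

Section with_basis.
Variables (J : choiceType) (u : J -> K) (bu : orthonormal_basis u).

Lemma hs_sum_fine T : hs_sum u T = (fine (hs_sum u T))%:E.
Proof.
rewrite fineK // ge0_fin_numE ?hs_fin //; first exact: tensorP.
by apply: esum_ge0 => j _; rewrite lee_fin sqr_ge0.
Qed.

Lemma hs_sums_ex Q T : exists s, sums (fun j => inner (Q (u j)) (T (u j)) : C^o) s.
Proof.
apply: sums_abs; apply/esum_bddP; first by move=> j; rewrite rnorm_ge0.
have fQ := hs_fin (tensorP Q) bu; have fT := hs_fin (tensorP T) bu.
have [M hM] : exists M, forall A : {fset J}, \sum_(i <- A) rnorm (Q (u i)) ^+ 2 <= M.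
  by apply/esum_bddP => // j; rewrite sqr_ge0.
have [N hN] : exists N, forall A : {fset J}, \sum_(i <- A) rnorm (T (u i)) ^+ 2 <= N.
  by apply/esum_bddP => // j; rewrite sqr_ge0.
exists (M + N) => A; rewrite (le_trans _ (lerD (hM A) (hN A))) // -big_split /=.
apply: ler_sum => j _; rewrite (le_trans (rnorm_inner _ _)) //.
have := rnorm_ge0 (Q (u j)); have := rnorm_ge0 (T (u j)).
by set x := rnorm _; set y := rnorm _ => ? ?; nra.
Qed.

Definition hs_form Q T : C :=
  summability.sum (fun j => inner (Q (u j)) (T (u j)) : C^o).

Lemma hs_form_sums Q T :
  sums (fun j => inner (Q (u j)) (T (u j)) : C^o) (hs_form Q T).
Proof. by have [s ss] := hs_sums_ex Q T; rewrite /hs_form (sumE ss). Qed.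
Arguments hs_form_sums : clear implicits.

Lemma hs_formDl a Q Q' T : hs_form (a *: Q + Q') T = a * hs_form Q T + hs_form Q' T.
Proof.
have := @sumsZD _ _ C^o _ _ a _ _ (hs_form_sums Q T) (hs_form_sums Q' T).
apply: (@sums_unique _ _ C^o); have := hs_form_sums (a *: Q + Q') T.
rewrite (_ : (fun j => _) =
  fun j => a *: (inner (Q (u j)) (T (u j)) : C^o) + inner (Q' (u j)) (T (u j))) //.
by apply/funext => j; rewrite innerDl innerZl.
Qed.

Lemma hs_formC Q T : hs_form Q T = (hs_form T Q)^*.
Proof.
apply: (@sums_unique _ _ C^o _ _ _ (hs_form_sums Q T)).
have := @sums_map _ _ C^o C^o (fun z : C => z^*) 1 _ _ (rmorphD _) _ (hs_form_sums T Q).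
rewrite (_ : _ \o _ = fun j => inner (Q (u j)) (T (u j))); last first.
  by apply/funext => j /=; rewrite innerC.
by apply => v; rewrite mul1r rnorm_conj.
Qed.

Lemma hs_form_sqr T : hs_form T T = (fine (hs_sum u T))%:C%C.
Proof.
have nn j : 0 <= rnorm (T (u j)) ^+ 2 by rewrite sqr_ge0.
apply: (@sums_unique _ _ C^o _ _ _ (hs_form_sums T T)).
have := sums_esum nn (hs_sum_fine T).
by rewrite (_ : (fun j => _) = fun j => inner (T (u j)) (T (u j))) //;
  apply/funext => j; rewrite innerrE.
Qed.

End with_basis.

(* An orthonormal basis chosen once and for all; by hs_innerE the inner product
   of the tensor product does not depend on it. *)
Definition onb_set (X : hilbertType R) : set X := projT1 (cid (onb_exists X)).
Arguments onb_set : clear implicits.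
Definition onb (X : hilbertType R) : onb_set X -> X := fun b => val b.

Lemma onbP (X : hilbertType R) : orthonormal_basis (@onb X).
Proof. exact: projT2 (cid (onb_exists X)). Qed.

Definition hs_inner Q T : C :=
  summability.sum (fun j => inner (Q (onb j)) (T (onb j)) : C^o).

Lemma hs_inner_linear T : GRing.linear_for *%R (hs_inner ^~ T).
Proof. by move=> a Q Q'; exact: hs_formDl (onbP K) _ _ _ _. Qed.

Lemma hs_innerC Q T : hs_inner Q T = (hs_inner T Q)^*.
Proof. exact: hs_formC (onbP K) _ _. Qed.

Lemma hs_inner_sqr T : hs_inner T T = (fine (hs_sum (@onb K) T))%:C%C.
Proof. exact: hs_form_sqr (onbP K) _. Qed.

Lemma hs_inner_linearr T : GRing.linear_for (conjC \; *%R) (hs_inner T).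
Proof.
move=> a Q Q' /=; rewrite hs_innerC hs_inner_linear rmorphD rmorphM /=.
by rewrite -!hs_innerC.
Qed.

Lemma hs_inner_gt0 T : T != 0 -> 0 < hs_inner T T.
Proof.
rewrite hs_inner_sqr ltcR ltNge; apply: contra => T0.
apply/eqP/tensor_eqP => k /=; apply: rnorm_eq0; apply/eqP.
rewrite -sqrf_eq0 eq_le sqr_ge0 andbT.
have := @hs_bound _ _ _ _ _ T (fine (hs_sum (@onb K) T)) k (tensor_anti T) (tensor_bdd T) (onbP K).
rewrite -hs_sum_fine; last exact: onbP.
move=> /(_ (lexx _)) /le_trans; apply.
by rewrite mulr_le0_ge0 ?sqr_ge0.
Qed.

End tensor_inner.
Arguments onb_set {R} X.
Arguments onbP {R} X.

Section tensor_hilbert.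
Variables (R : realType) (H K : hilbertType R).
Local Notation C := R[i].
Local Notation HK := (tensor H K).
Local Notation ip := (@hs_inner R H K).

HB.instance Definition _ := @bilinear_isBilinear.Build C HK HK C *%R (conjC \; *%R)
  ip (@hs_inner_linear R H K, @hs_inner_linearr R H K).

Let hs_inner_herm Q T : ip Q T = (-1) ^+ false * (ip T Q)^*.
Proof. by rewrite mul1r hs_innerC. Qed.

HB.instance Definition _ :=
  @isHermitianSesquilinear.Build C HK false conjC ip hs_inner_herm.

HB.instance Definition _ := @isDotProduct.Build C HK ip (@hs_inner_gt0 R H K).

Definition hs_norm (T : HK) : C := sqrtC (ip T T).

Let hs_norm_triangle Q T : hs_norm (Q + T) <= hs_norm Q + hs_norm T.
Proof. exact: (dot_triangle (ip : {dot HK for conjC})). Qed.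

Let hs_normZ (a : C) T : hs_norm (a *: T) = `|a| * hs_norm T.
Proof.
rewrite /hs_norm (dnormZ (ip : {dot HK for conjC})) sqrtCM ?nnegrE ?exprn_ge0 //.
by rewrite sqrCK.
Qed.

Let hs_norm0_eq0 T : hs_norm T = 0 -> T = 0.
Proof.
move/eqP; rewrite sqrtC_eq0 => /eqP T0; apply/eqP.
by rewrite -(dnorm_eq0 (ip : {dot HK for conjC})); apply/eqP.
Qed.

HB.instance Definition _ :=
  Lmodule_isNormed.Build C HK hs_norm_triangle hs_normZ hs_norm0_eq0.

Lemma tensor_normE (T : HK) : `|T| ^+ 2 = hs_inner T T.
Proof. exact: sqrtCK. Qed.

Lemma tensor_rnormE (T : HK) : rnorm T ^+ 2 = fine (hs_sum (@onb R K) T).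
Proof.
by apply: complexI; rewrite rmorphXn /= rnormE tensor_normE hs_inner_sqr.
Qed.

Lemma tensor_bound (T : HK) k : rnorm (T k) <= rnorm T * rnorm k.
Proof.
rewrite -(ler_pXn2r (n := 2)) ?nnegrE ?mulr_ge0 ?rnorm_ge0 // exprMn.
apply: (hs_bound _ (tensor_anti T) (tensor_bdd T) (onbP K)).
by rewrite tensor_rnormE -hs_sum_fine //; exact: onbP.
Qed.

Lemma tensor_fsum (T : HK) (A : {fset onb_set K}) :
  \sum_(j <- A) rnorm (T (onb j)) ^+ 2 <= rnorm T ^+ 2.
Proof.
rewrite tensor_rnormE -lee_fin -hs_sum_fine; last exact: onbP.
by apply: fsum_le_esum => j; rewrite sqr_ge0.
Qed.

Lemma tensor_complete (F : set_system HK) : ProperFilter F -> cauchy F -> cvg F.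
Proof.
move=> FF /cauchy_ballP Fc.
have small (e : R) : 0 < e -> exists2 A : set HK, F A &
   forall P Q, A P -> A Q -> rnorm (P - Q) < e.
  move=> e0; have e0' : (0 : C) < e%:C%C by rewrite ltcR.
  have [[A B] [/= FA FB] AB] := Fc _ e0'.
  exists (A `&` B); first exact: filterI.
  move=> z w [Az _] [_ Bw]; have := AB (z, w) (conj Az Bw).
  by rewrite -ball_normE /ball_ /= -rnormE ltcR.
have pt k : exists x : H, (fun P : HK => P k) @ F --> x.
  apply/cvg_ex; apply: cauchy_cvg; apply/cauchy_ballP => e /ltcRe[r r0 ->].
  have r0' : 0 < r / (rnorm k + 1) by rewrite divr_gt0 // ltr_wpDl ?rnorm_ge0.
  have [A FA Ae] := small _ r0'.
  exists ((fun P : HK => P k) @` A, (fun P : HK => P k) @` A).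
    by split; rewrite /= /nbhs /=; apply: filterS FA => z Az; exists z.
  move=> [_ _] [[P AP <-] [Q AQ <-]].
  rewrite -ball_normE /ball_ /= -rnormE ltcR.
  apply: le_lt_trans (tensor_bound (P - Q) k) _.
  have := Ae _ _ AP AQ; rewrite ltr_pdivlMr ?ltr_wpDl ?rnorm_ge0 //.
  by apply: le_lt_trans; rewrite ler_wpM2l ?rnorm_ge0 // lerDl.
have [T cvT] := choice pt.
have aT : antilinear T.
  move=> a k l.
  have h : (fun P : HK => P (a *: k + l)) @ F --> a^* *: T k + T l.
    rewrite (_ : (fun P : HK => _) = fun P : HK => a^* *: P k + P l); last first.
      by apply/funext => P; rewrite (tensor_anti P).
    by apply: cvgD => //; apply: cvgZr.
  exact: (cvg_unique _ (cvT _) h).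
have near_pt k e : 0 < e -> \forall P \near F, rnorm (T k - (P : HK) k) < e.
  move=> e0; have /cvgrPdist_lt/(_ e%:C%C) := cvT k.
  rewrite ltcR => /(_ e0) h; near=> P; rewrite -ltcR rnormE.
  by near: P.
have cvd (Q : HK) k : (fun P : HK => rnorm (P k - Q k)) @ F --> rnorm (T k - Q k).
  apply/cvgrPdist_lt => d d0; near=> P.
  have h : rnorm (T k - P k) < d by near: P; exact: near_pt.
  apply: le_lt_trans h; apply: le_trans (rnorm_dist _ _) _.
  by rewrite opprB addrA subrK.
have key e : 0 < e -> exists2 A : set HK, F A & forall Q, A Q ->
    exists2 Th : HK, Th = T :> (K -> H) & rnorm (Th - Q) <= e.
  move=> e0; have [A FA Ae] := small _ e0; exists A => // Q AQ.
  pose D k := T k - Q k.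
  have Dsum (X : {fset onb_set K}) : \sum_(j <- X) rnorm (D (onb j)) ^+ 2 <= e ^+ 2.
    have cvX : (fun P : HK => \sum_(j <- X) rnorm (P (onb j) - Q (onb j)) ^+ 2) @ F
        --> \sum_(j <- X) rnorm (D (onb j)) ^+ 2.
      elim: (X : seq _) => [|j r IH].
        rewrite big_nil (_ : (fun P : HK => _) = fun=> 0); first exact: cvg_cst.
        by apply/funext => P; rewrite big_nil.
      rewrite big_cons (_ : (fun P : HK => _) = fun P : HK =>
        rnorm (P (onb j) - Q (onb j)) ^+ 2 +
        \sum_(j <- r) rnorm (P (onb j) - Q (onb j)) ^+ 2); last first.
        by apply/funext => P; rewrite big_cons.
      by apply: cvgD => //; rewrite expr2; apply: cvgM; exact: cvd.
    rewrite -(cvg_lim _ cvX) //; apply: limr_le; first exact/cvgP/cvX.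
    near=> P; apply: le_trans (tensor_fsum (P - Q) X) _.
    rewrite ler_pXn2r ?nnegrE ?rnorm_ge0 ?ltW // Ae //.
    by near: P.
  have aD : antilinear D.
    move=> a k l; rewrite /D aT (tensor_anti Q) opprD addrACA scalerBr.
    by [].
  have bD : bounded_map D.
    exists e => k; rewrite -(cvg_lim _ (cvd Q k)) //.
    apply: limr_le; first exact/cvgP/cvd.
    near=> P; apply: le_trans (tensor_bound (P - Q) k) _.
    rewrite ler_wpM2r ?rnorm_ge0 // ltW // Ae //.
    by near: P.
  have hD : (hs_sum (@onb R K) D <= (e ^+ 2)%:E)%E by exact: esum_leP.
  have DP : D \in @hs_pred R H K.
    apply/mem_set; split => //; exists (onb_set K), (@onb R K).
    by split; [exact: onbP|rewrite (le_lt_trans hD) ?ltry].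
  exists (Tensor DP + Q).
    by apply/funext => k; rewrite /= /D subrK.
  rewrite addrK; have : rnorm (Tensor DP) ^+ 2 <= e ^+ 2.
    rewrite tensor_rnormE -lee_fin -hs_sum_fine //; exact: onbP.
  by rewrite ler_pXn2r // ?nnegrE ?rnorm_ge0 // ltW.
have [A1 FA1 kA1] := key 1 ltr01.
have [Q0 /kA1[Th ThT _]] := filter_ex FA1.
apply/cvg_ex; exists Th; apply/cvgrPdist_lt => e /ltcRe[r r0 ->].
have r20 : 0 < r / 2 by rewrite divr_gt0.
have [A FA kA] := key _ r20.
near=> Q; rewrite -rnormE ltcR.
have /kA[Th' Th'T h] : A Q by near: Q.
have -> : Th = Th' by apply: tensor_eqP => k; rewrite ThT Th'T.
by rewrite (le_lt_trans h) // ltr_pdivrMr // ltr_pMr // ltr1n.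
Unshelve. all: by end_near. Qed.

HB.instance Definition _ := Uniform_isComplete.Build HK tensor_complete.

HB.instance Definition _ := @isHilbert.Build R HK ip
  (fun T => esym (tensor_normE T)).

End tensor_hilbert.

Section elementary.
Variables (R : realType) (H K : hilbertType R) (x : H) (y : K).

Lemma tens_hs : (fun k : K => inner y k *: x) \in @hs_pred R H K.
Proof.
apply/mem_set; split.
- move=> a u v; rewrite innerDr innerZr scalerDl scalerA.
  by [].
- exists (rnorm y * rnorm x) => u.
  by rewrite rnormZ mulrAC ler_wpM2r ?rnorm_ge0 // rnorm_inner.
- exists (onb_set K), (@onb R K); split; first exact: onbP.
  have /esum_bddP[|M hM] := bessel_fin y (onbP K).1.
    by move=> j; rewrite sqr_ge0.
  apply/esum_bddP; first by move=> j; rewrite sqr_ge0.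
  exists (M * rnorm x ^+ 2) => A.
  apply: le_trans (ler_wpM2r _ (hM A)); rewrite ?sqr_ge0 // mulr_suml.
  by apply: ler_sum => j _; rewrite rnormZ exprMn.
Qed.

(* The elementary tensor of x and y. *)
Definition tens : tensor H K := Tensor tens_hs.

End elementary.

Lemma hs_innerE (R : realType) (H K : hilbertType R) (J : choiceType) (u : J -> K)
    (Q T : tensor H K) : orthonormal_basis u ->
  inner Q T = summability.sum (fun j => inner (Q (u j)) (T (u j)) : R[i]^o).
Proof.
move=> bu; rewrite -/(hs_form u Q T).
pose d (Q T : tensor H K) := inner Q T - hs_form u Q T.
have dC P S : d P S = (d S P)^*.
  by rewrite /d rmorphB /= innerC -(hs_formC bu).
have dl a P P' S : d (a *: P + P') S = a * d P S + d P' S.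
  rewrite /d innerDl innerZl (hs_formDl bu); ring.
have d0 P : d P P = 0.
  rewrite /d (hs_form_sqr bu) [inner P P]hs_inner_sqr.
  rewrite (hs_sum_indep (tensor_anti P) (tensor_bdd P) bu (onbP K)).
  by rewrite subrr.
have re a P S : a * d P S + (a * d P S)^* = 0.
  have := d0 (a *: P + S); rewrite dl [d P _]dC [d S _]dC !dl !d0.
  by rewrite mulr0 add0r addr0 -dC.
have z1 := re 1 Q T; have z2 := re 'i Q T.
rewrite mul1r in z1; rewrite rmorphM /= conjCi in z2.
have {}z1 : (d Q T)^* = - d Q T by apply/eqP; rewrite -addr_eq0 addrC z1.
rewrite z1 mulrNN -mulr2n in z2.
apply/eqP; rewrite -subr_eq0 -/(d Q T).
by move/eqP: z2; rewrite mulrn_eq0 /= mulf_eq0 (negbTE (neq0Ci _)).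
Qed.

Section frames.
Variable R : realType.

Definition separable (T : topologicalType) :=
  exists2 D : set T, countable D & dense D.

Variables (H : hilbertType R) (I : countType).
Implicit Type x : I -> H.

Definition is_frame x := exists A B : R, [/\ 0 < A, 0 < B &
  forall v : H,
    ((A * rnorm v ^+ 2)%:E
       <= \esum_(i in [set: I]) (rnorm (inner v (x i)) ^+ 2)%:E
       <= (B * rnorm v ^+ 2)%:E)%E].

Definition frame_operator x (v : H) : H :=
  summability.sum (fun i => inner v (x i) *: x i).

(* The frame operator S of a frame is bijective, and 'pinv_(fun=> 0) setT S is
   then its inverse; for families that are not frames the value is junk. *)
Definition dual_frame x (i : I) : H :=
  'pinv_(fun=> 0) [set: H] (frame_operator x) (x i).

End frames.

(* Main.v *)
(* The frame operator S is bounded, self-adjoint and bounded below, so 1 - tS is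
   a contraction for small t > 0 and S is bijective; hence the dual frame vector
   x' is the unique solution z of S z = x, and it suffices to compute frame
   operators: S_(x (x) y) (u (x) v) = S_x u (x) S_y v,
   S_(lambda x) = |lambda|^2 S_x and S_(x') = S_x^-1. For the tensor family only
   the upper frame bound and completeness are needed, as they make its frame
   operator convergent and injective. *)
Require Import Defs.
From mathcomp Require Import all_boot all_order all_algebra finmap.
From mathcomp Require Import complex.
From mathcomp Require Import all_classical all_reals.
From mathcomp Require Import topology normedtype sequences esum.
From mathcomp Require Import ring lra.

Set Implicit Arguments.
Unset Strict Implicit.
Unset Printing Implicit Defensive.

Import Order.TTheory GRing.Theory Num.Theory Num.Def.
Import numFieldNormedType.Exports.

Local Open Scope classical_set_scope.
Local Open Scope ring_scope.

(** * Bessel families and convergence of their expansions *)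

Section bessel_families.
Variable R : realType.
Local Notation C := R[i].

Lemma sums_rnorm_le (I : choiceType) (V : normedModType C) (x : I -> V) s M :
  sums x s -> (forall A : {fset I}, rnorm (\sum_(i <- A) x i) <= M) ->
  rnorm s <= M.
Proof.
move=> /sumsP xs hM; apply/ler_addgt0Pr => e e0.
have [A hA] := xs e e0.
rewrite -[s](subrK (\sum_(i <- A) x i)) (le_trans (rnormD _ _)) // addrC.
by rewrite lerD // ltW // hA // fsubset_refl.
Qed.

(** The upper frame bound, put on finite partial sums so that it feeds Cauchy arguments directly;
    [B] is positive so that one can divide by it. *)
Definition bessel (I : choiceType) (H : hilbertType R) (x : I -> H) (B : R) :=
  0 < B /\ forall v (A : {fset I}),
    \sum_(i <- A) rnorm (inner v (x i)) ^+ 2 <= B * rnorm v ^+ 2.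

(** The synthesis map inherits the bound of its adjoint, the analysis map: pair the finite sum [s]
    with itself and apply the Bessel bound to [s]. *)
Lemma bessel_fsum (I : choiceType) (H : hilbertType R) (x : I -> H) B
    (c : I -> C) (A : {fset I}) : bessel x B ->
  rnorm (\sum_(i <- A) c i *: x i) ^+ 2 <= B * \sum_(i <- A) rnorm (c i) ^+ 2.
Proof.
move=> [B0 hB]; set s := \sum_(i <- A) _.
have ss : rnorm s ^+ 2 <= \sum_(i <- A) rnorm (c i) * rnorm (inner s (x i)).
  rewrite -[leLHS]rnorm_real ?sqr_ge0 // -innerrE {1}/s inner_suml.
  rewrite (le_trans (rnorm_sum _ _)) //; apply: ler_sum => i _.
  by rewrite innerZl rnormM -innerC rnorm_conj.
(* AM-GM: [2 B |c_i| |<s, x_i>| <= B^2 |c_i|^2 + |<s, x_i>|^2] *)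
have h : 2 * B * rnorm s ^+ 2 <=
    B ^+ 2 * \sum_(i <- A) rnorm (c i) ^+ 2 + B * rnorm s ^+ 2.
  apply: le_trans (lerD (lexx _) (hB s A)).
  have B20 : 0 <= 2 * B by rewrite mulr_ge0 // ltW.
  apply: le_trans (ler_wpM2l B20 ss) _; rewrite !mulr_sumr -big_split /=.
  apply: ler_sum => i _; rewrite -subr_ge0.
  set a := rnorm (c i); set b := rnorm (inner _ _).
  by rewrite (_ : _ - _ = (B * a - b) ^+ 2) ?sqr_ge0 //; ring.
rewrite -(ler_pM2l B0); set X := \sum_(i <- A) _ in h *; lra.
Qed.

Lemma bessel_esum_fin (I : choiceType) (H : hilbertType R) (x : I -> H) B v :
  bessel x B ->
  (\esum_(i in [set: I]) (rnorm (inner v (x i)) ^+ 2)%:E)%E \is a fin_num.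
Proof.
move=> [_ hB]; have nn i : 0 <= rnorm (inner v (x i)) ^+ 2 by rewrite sqr_ge0.
rewrite ge0_fin_numE; first by apply/esum_bddP => //; exists (B * rnorm v ^+ 2).
by apply: esum_ge0 => i _; rewrite lee_fin.
Qed.

(** The squared coefficients are summable, so their tails are small, and [bessel_fsum] carries this
    over to the tails of the vector series. *)
Lemma bessel_sums (I : choiceType) (H : hilbertType R) (x : I -> H) B v :
  bessel x B -> exists s, sums (fun i => inner v (x i) *: x i) s.
Proof.
move=> bx; have [B0 hB] := bx.
have nn i : 0 <= rnorm (inner v (x i)) ^+ 2 by rewrite sqr_ge0.
have /(esum_tail nn) h : (\esum_(i in [set: I]) (rnorm (inner v (x i)) ^+ 2)%:E < +oo)%E.
  by rewrite ltey_eq (bessel_esum_fin v bx).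
apply: sums_cauchy; first exact: cauchy_cvg.
move=> e e0; have [|A0 hA] := h (e ^+ 2 / B); first by rewrite divr_gt0 // exprn_gt0.
exists A0 => D /hA; rewrite ltr_pdivlMr // mulrC => hD.
rewrite -(ltr_pXn2r (n := 2)) ?nnegrE ?rnorm_ge0 ?(ltW e0) //.
exact: le_lt_trans (bessel_fsum _ _ bx) hD.
Qed.

End bessel_families.

(** * The frame operator of a Bessel family, and surjectivity of [1 - G] for a contraction [G] *)

Section frame_operators.
Variables (R : realType) (I : countType) (H : hilbertType R).
Local Notation C := R[i].
Variables (x : I -> H) (B : R).
Hypothesis bx : bessel x B.
Local Notation S := (frame_operator x).

(** [frame_operator] is a limit that is meaningful only under convergence; the facts about [S] below
    rest on this one. *)
Lemma frame_operator_sums v : sums (fun i => inner v (x i) *: x i) (S v).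
Proof. by have [s ss] := bessel_sums v bx; rewrite /frame_operator (sumE ss). Qed.
Arguments frame_operator_sums : clear implicits.

Lemma frame_operatorZD a u v : S (a *: u + v) = a *: S u + S v.
Proof.
apply: (sums_unique (frame_operator_sums (a *: u + v))).
have := @sumsZD _ _ H _ _ a _ _ (frame_operator_sums u) (frame_operator_sums v).
rewrite (_ : (fun i => _) = fun i => inner (a *: u + v) (x i) *: x i) //.
by apply/funext => i; rewrite innerDl innerZl scalerDl scalerA.
Qed.

Lemma frame_operatorD u v : S (u + v) = S u + S v.
Proof. by rewrite -[u]scale1r frame_operatorZD !scale1r. Qed.

Lemma frame_operator0 : S 0 = 0.
Proof. by apply: (addrI (S 0)); rewrite -frame_operatorD !addr0. Qed.

Lemma frame_operatorZ a v : S (a *: v) = a *: S v.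
Proof. by rewrite -[a *: v]addr0 frame_operatorZD frame_operator0 addr0. Qed.

Lemma frame_operatorB u v : S (u - v) = S u - S v.
Proof. by rewrite frame_operatorD -scaleN1r frame_operatorZ scaleN1r. Qed.

Lemma frame_operator_selfadj u v : inner (S u) v = inner u (S v).
Proof.
have h1 := @sums_innerl _ _ H _ _ v (frame_operator_sums u).
have h2 := @sums_innerr _ _ H _ _ u (frame_operator_sums v).
apply: (@sums_unique _ _ C^o _ _ _ h1); move: h2; congr sums.
by apply/funext => i; rewrite innerZl innerZr innerC mulrC.
Qed.

Lemma frame_operator_quad v :
  inner (S v) v = (fine (\esum_(i in [set: I]) (rnorm (inner v (x i)) ^+ 2)%:E))%:C%C.
Proof.
have nn i : 0 <= rnorm (inner v (x i)) ^+ 2 by rewrite sqr_ge0.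
have Sf := esym (fineK (bessel_esum_fin v bx)).
apply: (@sums_unique _ _ C^o _ _ _ (@sums_innerl _ _ H _ _ v (frame_operator_sums v))).
have := sums_esum nn Sf; congr sums.
by apply/funext => i; rewrite innerZl -[inner (x i) v]innerC sqr_rnormC.
Qed.

(** Analysis and synthesis each contribute a factor [sqrt B]. *)
Lemma frame_operator_bound v : rnorm (S v) <= B * rnorm v.
Proof.
have [B0 hB] := bx.
apply: (sums_rnorm_le (frame_operator_sums v)) => A.
rewrite -(ler_pXn2r (n := 2)) ?nnegrE ?mulr_ge0 ?rnorm_ge0 ?(ltW B0) //.
apply: le_trans (bessel_fsum _ _ bx) _.
by rewrite exprMn expr2 -mulrA ler_pM2l.
Qed.

(** If [S d = 0], then [<S d, d>], the sum of the squared coefficients of [d], vanishes, and so does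
    each coefficient. Completeness is the form in which injectivity passes to the tensor family. *)
Lemma frame_operator_inj : (forall v, (forall i, inner v (x i) = 0) -> v = 0) ->
  injective S.
Proof.
move=> cx u v Suv; apply/eqP; rewrite -subr_eq0; apply/eqP; apply: cx => i.
set d := u - v.
have : inner (S d) d = 0 by rewrite frame_operatorB Suv subrr inner0l.
rewrite frame_operator_quad => /complexI h.
have := fsum_le_esum (fun j => rnorm (inner d (x j)) ^+ 2) [fset i]%fset.
rewrite -[leRHS]fineK ?(bessel_esum_fin _ bx) // h big_seq_fset1 lee_fin => h0.
by apply: rnorm_eq0; apply/eqP; rewrite -sqrf_eq0 eq_le h0 sqr_ge0.
Qed.

End frame_operators.
Arguments frame_operator_sums {R I H x B} bx v.

(* Picard iteration for [v = y + G v]: the iterates satisfy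
   [v_(N+m) - v_N = G^N v_m] and all have norm at most [|y| / (1 - q)]. *)
Lemma contraction_sub_surj (R : realType) (V : completeNormedModType R[i])
    (G : V -> V) (q : R) (y : V) :
  {morph G : a b / a + b} -> 0 <= q < 1 ->
  (forall v, rnorm (G v) <= q * rnorm v) -> exists v, v - G v = y.
Proof.
move=> GD /andP[q0 q1] Gq.
have GB a b : G (a - b) = G a - G b.
  by apply/eqP; rewrite eq_sym subr_eq -GD subrK.
pose w n := iter n (fun v => y + G v) 0.
pose c := rnorm y / (1 - q).
have q1' : 0 < 1 - q by rewrite subr_gt0.
have c0 : 0 <= c by rewrite divr_ge0 ?rnorm_ge0 // ltW.
have wc m : rnorm (w m) <= c.
  elim: m => [|m IH] /=; first by rewrite rnorm0.
  (* [c] is the fixed point of [r |-> |y| + q r], so the bound reproduces itself. *)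
  have -> : c = rnorm y + q * c.
    by rewrite /c; field; rewrite gt_eqF.
  rewrite (le_trans (rnormD _ _)) // lerD2l (le_trans (Gq _)) //.
  by rewrite ler_wpM2l.
have wd N m : rnorm (w (N + m)%N - w N) <= q ^+ N * c.
  elim: N => [|N IH]; first by rewrite subr0 expr0 mul1r wc.
  rewrite addSn /= opprD addrACA subrr add0r -GB (le_trans (Gq _)) //.
  by rewrite exprS -mulrA ler_wpM2l.
have small (e : R) : 0 < e -> exists N, q ^+ N * c < e.
  (* Dividing by [c + 1] covers the case [c = 0]. *)
  move=> e0; have c1 : 0 < c + 1 by rewrite ltr_wpDl.
  have aq : `|q| < 1 by rewrite ger0_norm.
  have /cvgrPdist_lt/(_ (e / (c + 1))) := cvg_expr aq.
  rewrite divr_gt0 // => /(_ isT)[N _ /(_ N (leqnn N))] /=.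
  rewrite sub0r normrN ger0_norm ?exprn_ge0 // ltr_pdivlMr // => h.
  exists N; apply: le_lt_trans h.
  by rewrite ler_wpM2l ?exprn_ge0 // lerDl.
have /cvg_ex[v wv] : cvg (w @ \oo).
  apply: cauchy_cvg; apply: cauchy_exP => e /ltcRe[r r0 ->].
  have [N hN] := small r r0; exists (w N); exists N => // n /= Nn.
  rewrite -ball_normE /ball_ /= -rnormE ltcR -rnormN opprB.
  by rewrite -(subnKC Nn) (le_lt_trans (wd _ _)).
exists v; apply/eqP; rewrite -subr_eq0; apply/eqP; apply: rnorm_eq0.
apply/eqP; rewrite eq_le rnorm_ge0 andbT.
apply/ler_addgt0Pr => e e0; rewrite add0r.
have e20 : 0 < e / 2 by rewrite divr_gt0.
have /cvgrPdist_lt/(_ (e / 2)%:C%C) := wv.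
rewrite ltcR => /(_ e20)[N _ hN].
have h1 : rnorm (v - w N) < e / 2 by rewrite -ltcR rnormE hN /=.
have h2 : rnorm (v - w N.+1) < e / 2 by rewrite -ltcR rnormE hN /=.
(* Uses [w N.+1 = y + G (w N)]; both differences are below [e / 2]. *)
have -> : v - G v - y = (v - w N.+1) - G (v - w N).
  by rewrite GB /= opprD opprB !addrA subrK addrAC.
rewrite [leRHS]splitr ltW // (le_lt_trans (rnormD _ _)) // ltrD // rnormN.
rewrite (le_lt_trans (Gq _)) // (le_lt_trans _ h1) // ler_piMl ?rnorm_ge0 //.
exact: ltW.
Qed.

(** * Invertibility of the frame operator and the dual frame *)

Section frame_inverse.
Variables (R : realType) (I : countType) (H : hilbertType R).
Variable x : I -> H.
Local Notation S := (frame_operator x).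

Lemma is_frame_bounds : is_frame x -> exists A B : R, [/\ 0 < A, bessel x B &
  forall v, (A * rnorm v ^+ 2)%:C%C <= inner (S v) v].
Proof.
move=> [A [B [A0 B0 hAB]]]; have bx : bessel x B.
  split=> // v D; rewrite -lee_fin; have /andP[_] := hAB v; apply: le_trans.
  exact: fsum_le_esum (fun i => rnorm (inner v (x i)) ^+ 2) D.
exists A, B; split=> // v; rewrite (frame_operator_quad bx) lecR.
by rewrite -lee_fin fineK ?(bessel_esum_fin _ bx) //; have /andP[] := hAB v.
Qed.

Lemma is_frame_complete v : is_frame x -> (forall i, inner v (x i) = 0) -> v = 0.
Proof.
move=> [A [B [A0 B0 hAB]]] v0; have /andP[+ _] := hAB v.
rewrite esum1 => [|i _]; last by rewrite v0 rnorm0 expr0n.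
rewrite lee_fin pmulr_rle0 // => h; apply: rnorm_eq0; apply/eqP.
by rewrite -sqrf_eq0 eq_le h sqr_ge0.
Qed.

Lemma is_frame_inj : is_frame x -> injective S.
Proof.
move=> fx; have [A [B [_ bx _]]] := is_frame_bounds fx.
by apply: (frame_operator_inj bx) => v; exact: is_frame_complete.
Qed.

(* [1 - t S] is a contraction for [t = A / (A + B)^2]. *)
Lemma is_frame_surj : is_frame x -> forall y, exists v, S v = y.
Proof.
move=> fx y; have [A [B [A0 bx hA]]] := is_frame_bounds fx.
have B0 := bx.1.
(* [A <= B] can fail when [H] is zero; [M] still bounds [S] and forces [A / M <= 1]. *)
pose M := A + B; have M0 : 0 < M by rewrite addr_gt0.
pose t := A / M ^+ 2; have t0 : 0 < t by rewrite divr_gt0 // exprn_gt0.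
(* [|v - t S v|^2 <= (1 - 2 t A + t^2 M^2) |v|^2]; the chosen [t] minimizes this factor, with value
   [q2]. *)
pose q2 := 1 - (A / M) ^+ 2.
have AM0 : 0 < A / M by rewrite divr_gt0.
have AM1 : A / M <= 1 by rewrite ler_pdivrMr // mul1r lerDl ltW.
have q20 : 0 <= q2 by rewrite subr_ge0 expr_le1 // ltW.
have q21 : q2 < 1 by rewrite ltrBlDr ltrDl exprn_gt0.
pose G v := v - t%:C%C *: S v.
have GD : {morph G : a b / a + b}.
  by move=> a b; rewrite /G (frame_operatorD bx) scalerDr opprD addrACA.
have Gq v : rnorm (G v) <= Num.sqrt q2 * rnorm v.
  rewrite -(ler_pXn2r (n := 2)) ?nnegrE ?mulr_ge0 ?sqrtr_ge0 ?rnorm_ge0 //.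
  rewrite exprMn sqr_sqrtr //.
  set r := fine (\esum_(i in [set: I]) (rnorm (inner v (x i)) ^+ 2)%:E)%E.
  have Sv : inner (S v) v = r%:C%C := frame_operator_quad bx v.
  have rA : A * rnorm v ^+ 2 <= r by rewrite -lecR -Sv.
  have SM : rnorm (S v) ^+ 2 <= M ^+ 2 * rnorm v ^+ 2.
    rewrite -exprMn ler_pXn2r ?nnegrE ?mulr_ge0 ?rnorm_ge0 ?(ltW M0) //.
    rewrite (le_trans (frame_operator_bound bx v)) // ler_wpM2r ?rnorm_ge0 //.
    by rewrite lerDr ltW.
  have -> : rnorm (G v) ^+ 2 = rnorm v ^+ 2 - 2 * t * r + t ^+ 2 * rnorm (S v) ^+ 2.
    apply: complexI; rewrite -innerrE /G innerBl !linearBr /= !innerZl !innerZr.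
    have conj_real (a : R) : conjC a%:C%C = a%:C%C := conjc_real a.
    rewrite -[inner v (S v)]innerC Sv !innerrE !conj_real.
    by ring.
  have h1 := ler_wpM2l (ltW t0) rA.
  have h2 := ler_wpM2l (sqr_ge0 t) SM.
  have -> : q2 * rnorm v ^+ 2 =
    rnorm v ^+ 2 - 2 * (t * (A * rnorm v ^+ 2)) + t ^+ 2 * (M ^+ 2 * rnorm v ^+ 2).
    by rewrite /q2 /t; field; rewrite gt_eqF.
  by lra.
(* Since [v - G v = t S v], solve for the right side [t y] and cancel [t]. *)
have [|v] := contraction_sub_surj (t%:C%C *: y) GD _ Gq.
  by rewrite sqrtr_ge0 -sqrtr1 ltr_sqrt.
rewrite /G subKr => /(scalerI _) h; exists v; apply: h.
by rewrite eq_complex /= negb_and gt_eqF.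
Qed.

Lemma dual_frame_eq i z : injective S -> S z = x i -> dual_frame x i = z.
Proof.
move=> iS Sz; rewrite /dual_frame -Sz pinvKV ?in_setT //.
by move=> a b _ _; exact: iS.
Qed.

Lemma frame_operator_dual i : is_frame x -> S (dual_frame x i) = x i.
Proof.
by move=> fx; have [v Sv] := is_frame_surj fx (x i);
  rewrite (dual_frame_eq (is_frame_inj fx) Sv).
Qed.

(** Apply the bounded map [P = S^-1] term by term to the series of [S u]. As
    [<u, x_i> = <u, S x_i'> = <S u, x_i'>], the result is the series of the frame operator of [x']
    at [S u]. *)
Lemma dual_frame_operator u : is_frame x -> frame_operator (dual_frame x) (S u) = u.
Proof.
move=> fx; have [A [B [A0 bx hA]]] := is_frame_bounds fx.
pose P y := sval (cid (is_frame_surj fx y)).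
have SP y : S (P y) = y := svalP (cid (is_frame_surj fx y)).
have PS v : P (S v) = v by apply: (is_frame_inj fx); rewrite SP.
have PD : {morph P : a b / a + b}.
  by move=> a b; apply: (is_frame_inj fx); rewrite (frame_operatorD bx) !SP.
(* Lower frame bound and Cauchy-Schwarz: [A |w|^2 <= <S w, w> <= |S w| |w|]. *)
have PA v : rnorm (P v) <= A^-1 * rnorm v.
  rewrite ler_pdivlMl //; set w := P v.
  have [->|w0] := eqVneq (rnorm w) 0; first by rewrite mulr0 rnorm_ge0.
  have wp : 0 < rnorm w by rewrite lt_def w0 rnorm_ge0.
  rewrite -(ler_pM2r wp) -mulrA -expr2 -(SP v) -/w.
  rewrite (le_trans _ (rnorm_inner _ _)) // -lecR rnormE.
  rewrite ger0_norm ?hA // (le_trans _ (hA w)) // ler0c.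
  by rewrite mulr_ge0 ?sqr_ge0 // ltW.
apply: sumE; have := sums_map PD PA (frame_operator_sums bx u).
rewrite PS; congr sums; apply/funext => i /=.
apply: (is_frame_inj fx); rewrite SP !(frame_operatorZ bx) frame_operator_dual //.
by rewrite (frame_operator_selfadj bx) frame_operator_dual.
Qed.

End frame_inverse.

(** * Dual frames of dual and of scaled families *)

Lemma dual_frame_involutive (R : realType) (I : countType) (H : hilbertType R)
  (x : I -> H) : is_frame x -> dual_frame (dual_frame x) =1 x.
Proof.
move=> fx i; apply: dual_frame_eq => [u v|]; last first.
  by rewrite -(frame_operator_dual i fx) dual_frame_operator.
(* Every vector is some [S a], and the operator of [x'] sends it back to [a]; this gives
   injectivity. *)
have [[a <-] [b <-]] := (is_frame_surj fx u, is_frame_surj fx v).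
by rewrite !dual_frame_operator // => ->.
Qed.

Lemma dual_frame_scale (R : realType) (I : countType) (H : hilbertType R)
    (x : I -> H) (a : R[i]) (i : I) : is_frame x -> a != 0 ->
  dual_frame (fun i => a *: x i) i = (a^*)^-1 *: dual_frame x i.
Proof.
move=> fx a0; have [A [B [_ bx _]]] := is_frame_bounds fx.
have aC0 : a^* != 0 by rewrite conjC_eq0.
(* One factor [a^*] comes from the coefficient, one factor [a] from the vector. *)
have Sa v : frame_operator (fun i => a *: x i) v = (a * a^*) *: frame_operator x v.
  apply: sumE; rewrite -(frame_operatorZ bx).
  have := frame_operator_sums bx ((a * a^*) *: v); congr sums.
  by apply/funext => j; rewrite innerZl innerZr scalerA; congr (_ *: _); ring.
apply: dual_frame_eq => [u v|].
  by rewrite !Sa => /(scalerI (mulf_neq0 a0 aC0)) /(is_frame_inj fx).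
by rewrite Sa (frame_operatorZ bx) scalerA mulfK // frame_operator_dual.
Qed.

(** * Products of finite index sets and the tensor family *)

Lemma big_fsetM (I J : choiceType) (V : nmodType) (F : I * J -> V)
    (A : {fset I}) (B : {fset J}) :
  \sum_(p <- (A `*` B)%fset) F p = \sum_(i <- A) \sum_(j <- B) F (i, j).
Proof.
rewrite -big_allpairs; apply: perm_big; apply: uniq_perm.
- exact: fset_uniq.
- by apply: allpairs_uniq => [||[] ? ? [] ? ?] //; exact: fset_uniq.
move=> [i j]; rewrite in_fsetM /=.
apply/andP/allpairsP => [[iA jB]|[[i' j'] /= [iA jB [-> ->]]]] //.
by exists (i, j).
Qed.

Lemma fset_sub_fsetM (I J : choiceType) (F : {fset I * J}) :
  (F `<=` [fset p.1 | p in F] `*` [fset p.2 | p in F])%fset.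
Proof.
by apply/fsubsetP => p pF; rewrite in_fsetM !in_imfset.
Qed.

Section tensor_frames.
Variables (R : realType) (H K : hilbertType R).

(** Expand [y] in the basis defining the inner product and apply the bounded antilinear [T] term by
    term. *)
Lemma inner_tensr (T : tensor H K) x y : inner T (tens x y) = inner (T y) x.
Proof.
apply: sumE.
have := @sums_innerl _ _ H _ _ x
  (antilinear_sums (tensor_anti T) (tensor_bdd T) (@onb_expansion _ _ _ _ y (onbP K))).
congr sums; apply/funext => j /=.
by rewrite (antilinearZ (tensor_anti T)) innerZl innerZr.
Qed.

Lemma tensBl x x' y : tens (x - x') y = tens x y - tens x' y :> tensor H K.
Proof. by apply: tensor_eqP => k /=; rewrite scalerBr. Qed.

Lemma tensBr x y y' : tens x (y - y') = tens x y - tens x y' :> tensor H K.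
Proof. by apply: tensor_eqP => k /=; rewrite innerBl scalerBl. Qed.

Lemma tens_suml (I : Type) (r : seq I) (x : I -> H) y :
  tens (\sum_(i <- r) x i) y = \sum_(i <- r) tens (x i) y :> tensor H K.
Proof.
apply: (big_morph (fun z => tens z y : tensor H K)) => [z z'|].
  by apply: tensor_eqP => k /=; rewrite scalerDr.
by apply: tensor_eqP => k /=; rewrite scaler0.
Qed.

Lemma tens_sumr (I : Type) (r : seq I) x (y : I -> K) :
  tens x (\sum_(i <- r) y i) = \sum_(i <- r) tens x (y i) :> tensor H K.
Proof.
apply: (big_morph (fun z => tens x z : tensor H K)) => [z z'|].
  by apply: tensor_eqP => k /=; rewrite innerDl scalerDl.
by apply: tensor_eqP => k /=; rewrite inner0l scale0r.
Qed.

Lemma tensZl a x y : tens (a *: x) y = a *: tens x y :> tensor H K.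
Proof. by apply: tensor_eqP => k /=; rewrite scalerA mulrC -scalerA. Qed.

Lemma tensZr a x y : tens x (a *: y) = a *: tens x y :> tensor H K.
Proof. by apply: tensor_eqP => k /=; rewrite innerZl -scalerA. Qed.

Lemma rnorm_tens x y : rnorm (tens x y : tensor H K) = rnorm x * rnorm y.
Proof.
apply/eqP; rewrite -(@eqrXn2 _ 2) ?mulr_ge0 ?rnorm_ge0 //; apply/eqP.
apply: complexI; rewrite -innerrE inner_tensr /= innerZl !innerrE.
by rewrite mulrC -rmorphM exprMn.
Qed.

(* The index sets of the form A `*` B are cofinal among the finite sets of pairs,
   and on them the partial sum factors. *)
Lemma sums_tens (I J : choiceType) (x : I -> H) (y : J -> K) s t
    (r : tensor H K) : sums x s -> sums y t ->
  sums (fun p : I * J => tens (x p.1) (y p.2)) r -> r = tens s t.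
Proof.
move=> /sumsP xs /sumsP yt /sumsP xyr.
apply/eqP; rewrite -subr_eq0; apply/eqP; apply: rnorm_eq0.
apply/eqP; rewrite eq_le rnorm_ge0 andbT.
apply/ler_addgt0Pr => e e0; rewrite add0r.
(* The total error is at most [d + d |t| + (|s| + d) d], hence at most [d c] once [d <= 1]. *)
pose c := rnorm s + rnorm t + 2.
have c0 : 0 < c by rewrite ltr_wpDl // addr_ge0 ?rnorm_ge0.
pose d := Num.min 1 (e / c).
have d0 : 0 < d by rewrite lt_min ltr01 divr_gt0.
have d1 : d <= 1 by rewrite ge_min lexx.
have de : d * c <= e by rewrite -ler_pdivlMr // ge_min lexx orbT.
have [A0 hA] := xs d d0; have [B0 hB] := yt d d0; have [F0 hF] := xyr d d0.
(* Adding the projections of [F0] makes the product of [A] and [B] contain [F0]. *)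
pose A := (A0 `|` [fset p.1 | p in F0])%fset.
pose B := (B0 `|` [fset p.2 | p in F0])%fset.
have {}hA := hA A (fsubsetUl _ _); have {}hB := hB B (fsubsetUl _ _).
have {}hF : rnorm (r - \sum_(p <- (A `*` B)%fset) tens (x p.1) (y p.2)) < d.
  apply: hF; apply/fsubsetP => p pF.
  by rewrite in_fsetM !inE !in_imfset // !orbT.
rewrite big_fsetM in hF.
set a := \sum_(i <- A) x i in hA; set b := \sum_(j <- B) y j in hB.
have tens_sum : \sum_(i <- A) \sum_(j <- B) tens (x i) (y j) = tens a b :> tensor H K.
  by rewrite tens_suml; apply: eq_bigr => i _; rewrite tens_sumr.
rewrite /= tens_sum in hF.
have -> : r - tens s t = (r - tens a b) - (tens (s - a) t + tens a (t - b)).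
  by rewrite tensBl tensBr addrA subrK opprB addrA subrK.
apply: le_trans (rnormD _ _) _; rewrite rnormN.
have h1 := rnormD (tens (s - a) t : tensor H K) (tens a (t - b)).
have h2 : rnorm a <= rnorm s + d.
  rewrite -[a](subrK s) addrC (le_trans (rnormD _ _)) // lerD2l.
  by rewrite -rnormN opprB ltW.
rewrite !rnorm_tens in h1.
have := rnorm_ge0 (s - a); have := rnorm_ge0 (t - b).
have := rnorm_ge0 s; have := rnorm_ge0 t; have := rnorm_ge0 a.
rewrite /c in de.
move: (rnorm (tens _ _ + _)) (rnorm (r - _)) (rnorm (s - a)) (rnorm (t - b))
  (rnorm s) (rnorm t) (rnorm a) hA hB hF h1 h2 de
  => z1 z2 z3 z4 z5 z6 z7 ? ? ? ? ? ? ? ? ? ? ?.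
have m1 : z3 * z6 <= d * z6 by rewrite ler_wpM2r // ltW.
have m2 : z7 * z4 <= (z5 + d) * d by apply: ler_pM => //; exact: ltW.
have m3 : d * d <= d by rewrite ler_piMl // ltW.
nra.
Qed.

Variables (I J : countType) (x : I -> H) (y : J -> K) (B D : R).
Hypotheses (bx : bessel x B) (byy : bessel y D).
Local Notation xy := (fun p : I * J => tens (x p.1) (y p.2)).

(* Expanding T y_j in an orthonormal basis v_l of H gives
   <T y_j, v_l> = <w_l, y_j>, so the Bessel bound of y applies to each w_l. *)
Lemma esum_tensor_bessel (T : tensor H K) :
  (\esum_(j in [set: J]) (rnorm (T (y j)) ^+ 2)%:E <= (D * rnorm T ^+ 2)%:E)%E.
Proof.
have [D0 hD] := byy.
have [L [v [w [bv adj]]]] := hs_adjoint (tensor_anti T) (tensor_bdd T).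
have -> : (\esum_(j in [set: J]) (rnorm (T (y j)) ^+ 2)%:E =
   \esum_(l in [set: L]) \esum_(j in [set: J]) (rnorm (inner (w l) (y j)) ^+ 2)%:E)%E.
  rewrite esum_swap; last by move=> i j; rewrite lee_fin sqr_ge0.
  apply: eq_esum => j _; rewrite -(parseval _ bv).
  by apply: eq_esum => l _; rewrite adj.
apply: (@le_trans _ _ (\esum_(l in [set: L]) (D * rnorm (w l) ^+ 2)%:E)%E).
  by apply: le_esum => l _; apply: esum_leP => A; exact: hD.
apply: esum_leP => A; rewrite -mulr_sumr ler_pM2l //.
(* [|T|^2] is also the sum of the [|w_l|^2], by passing to the adjoint. *)
rewrite tensor_rnormE -lee_fin -(hs_sum_fine (onbP K)).
rewrite (hs_sum_adjoint (onbP K) bv adj).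
exact: fsum_le_esum (fun l => rnorm (w l) ^+ 2) A.
Qed.

(** Enlarge the index set to a product. For fixed [j] the pairings are [<T y_j, x_i>], controlled by
    the bound of [x]; the sum over [j] is controlled by [esum_tensor_bessel]. *)
Lemma bessel_tens : bessel xy (B * D).
Proof.
have [[B0 hB] [D0 hD]] := (bx, byy).
split=> [|T A]; first exact: mulr_gt0.
rewrite -mulrA; set A1 := [fset p.1 | p in A]%fset; set A2 := [fset p.2 | p in A]%fset.
apply: (@le_trans _ _ (\sum_(p <- (A1 `*` A2)%fset) rnorm (inner T (xy p)) ^+ 2)).
  by rewrite [leRHS](big_fset_sub _ (fset_sub_fsetM A)) lerDl sumr_ge0 // => p _;
    rewrite sqr_ge0.
rewrite big_fsetM exchange_big /=.
apply: (@le_trans _ _ (\sum_(j <- A2) B * rnorm (T (y j)) ^+ 2)).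
  by apply: ler_sum => j _; under eq_bigr do rewrite inner_tensr; exact: hB.
rewrite -mulr_sumr ler_pM2l // -lee_fin.
apply: le_trans (esum_tensor_bessel T).
exact: fsum_le_esum (fun j => rnorm (T (y j)) ^+ 2) A2.
Qed.

(** The term at [(i, j)] is the elementary tensor of the terms at [i] and [j]; [bessel_tens] gives
    the convergence that [sums_tens] asks for. *)
Lemma frame_operator_tens u v :
  frame_operator xy (tens u v) = tens (frame_operator x u) (frame_operator y v).
Proof.
apply: (sums_tens (frame_operator_sums bx u) (frame_operator_sums byy v)).
have := frame_operator_sums bessel_tens (tens u v); congr sums.
apply/funext => -[i j] /=.
by rewrite inner_tensr /= innerZl tensZl tensZr scalerA mulrC.
Qed.

(** Completeness of [x] gives [T y_j = 0]. For fixed [h], write [<T k, h> = <w, k>]; then [w] is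
    orthogonal to every [y_j], so it vanishes. *)
Lemma tens_complete (T : tensor H K) :
  (forall v : H, (forall i, inner v (x i) = 0) -> v = 0) ->
  (forall v : K, (forall j, inner v (y j) = 0) -> v = 0) ->
  (forall p, inner T (xy p) = 0) -> T = 0.
Proof.
move=> cx cy T0; apply: tensor_eqP => k /=; apply: inner_ext => h.
have [w hw] := adjoint_exists h (tensor_anti T) (tensor_bdd T).
rewrite hw (cy w) ?inner0l // => j; rewrite -hw (cx (T (y j))) ?inner0l // => i.
by rewrite -inner_tensr (T0 (i, j)).
Qed.

End tensor_frames.

Lemma dual_frame_tens (R : realType) (H K : hilbertType R) (I J : countType)
    (x : I -> H) (y : J -> K) n m : is_frame x -> is_frame y ->
  dual_frame (fun p : I * J => tens (x p.1) (y p.2)) (n, m)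
  = tens (dual_frame x n) (dual_frame y m).
Proof.
move=> fx fy.
have [A [B [_ bx _]]] := is_frame_bounds fx.
have [A' [D [_ byy _]]] := is_frame_bounds fy.
apply: dual_frame_eq; last first.
  by rewrite (frame_operator_tens bx byy) !frame_operator_dual.
apply: (frame_operator_inj (bessel_tens bx byy)) => T.
by apply: tens_complete => v; exact: is_frame_complete.
Qed.

Theorem proposition3p2 (R : realType) (H K : hilbertType R)
    (sepH : separable H) (sepK : separable K)
    (I J : countType) (x : I -> H) (y : J -> K)
    (frame_x : is_frame x) (frame_y : is_frame y)
    (lambda : R[i]) (lambda_neq0 : lambda != 0) :
  [/\ forall (n : I) (m : J),
        dual_frame (fun p : I * J => tens (x p.1) (y p.2)) (n, m)
        = tens (dual_frame x n) (dual_frame y m),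
      forall n : I,
        dual_frame (fun i => lambda *: x i) n
        = (lambda^*)^-1 *: dual_frame x n
    & forall n : I, dual_frame (dual_frame x) n = x n].
Proof.
split=> [n m|n|n].
- exact: dual_frame_tens.
- exact: dual_frame_scale.
- exact: dual_frame_involutive.
Qed.
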